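(* Let $d,n>1$ and $k,r\ge 1$ be integers and let $H$ be a finite abelian group such that $\exp(H)\mid d^k$, $\gcd(d,n)\le d-1$ and $d^kn\ge 6$. Let $G=H\oplus C_{d^kn}^r$ and let $A=\{1,2,\ldots,d^kn-1\}\setminus\{d^kn/d^j : j\in[1,k]\}$. Then $G$ is $0$-complete with respect to $A$; that is, for every sequence $S$ over $G$, $$N_{A,0}(S)\ \ge\ 2^{|S|-D_A(G)+1}.$$
   Context: $C_m$ is the cyclic group of order $m$ (written additively), $C_m^r$ is the direct sum of $r$ copies of it, $\exp$ denotes the exponent of a group, and $[a,b]=\{x\in\mathbb{N}_0: a\le x\le b\}$. A sequence $S=g_1\cdots g_m$ over $G$ is a finite unordered list of elements of $G$ with repetition allowed (an element of the free abelian monoid on $G$), of length $|S|=m$; the empty sequence is allowed. Subsequences of $S$ correspond to index sets $I\subseteq[1,m]$, and subsequences with different index sets are considered different. For a nonempty set $A$ of integers, $D_A(G)$ (the $A$-weighted Davenport constant) is the smallest positive integer $t$ such that for every sequence $g_1\cdots g_t$ over $G$ of length $t$ there are a nonempty $I\subseteq[1,t]$ and $a_i\in A$ ($i\in I$) with $\sum_{i\in I}a_ig_i=0$. For $S=g_1\cdots g_m$ and $g\in G$, $N_{A,g}(S)$ is the number of subsets $I\subseteq[1,m]$ for which there exist $a_i\in A$ ($i\in I$) with $\sum_{i\in I}a_ig_i=g$. The empty set is allowed, with empty sum equal to $0$, so it is counted in $N_{A,0}(S)$. *)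

(* Defs.v *)
From HB Require Import structures.
From mathcomp Require Import all_boot all_order all_algebra all_fingroup all_solvable.
From mathcomp Require Import boolp classical_sets.

Set Implicit Arguments.
Unset Strict Implicit.
Unset Printing Implicit Defensive.

Import Order.TTheory GRing.Theory Num.Theory.
Local Open Scope ring_scope.

(* MathComp does not declare the finZmodType structure on products and on
   {ffun _ -> _}; these commands only join existing structures. *)
HB.saturate finfun_of.
HB.saturate prod.

(* Sequences over G are represented by lists: none of the notions below
   depends on the order of the terms. *)
Definition weighted_sum (G : finZmodType) (A : set int) (S : seq G)
    (I : {set 'I_(size S)}) (g : G) : Prop :=
  exists a : 'I_(size S) -> int,
    (forall i, i \in I -> A (a i)) /\ \sum_(i in I) S`_i *~ a i = g.

Definition zero_sum_length (G : finZmodType) (A : set int) (t : nat) : Prop :=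
  (0 < t)%N /\
  forall S : seq G, size S = t ->
    exists I : {set 'I_(size S)}, I != finset.set0 /\ weighted_sum A I 0.

(* The value is 0 when there is no such length, which by [davenportP] can only
   happen for A empty. *)
Definition davenport (G : finZmodType) (A : set int) : nat :=
  if pselect (exists t, `[< zero_sum_length G A t >]) is left ex_t
  then ex_minn ex_t else 0%N.

Definition num_subseq (G : finZmodType) (A : set int) (g : G) (S : seq G) : nat :=
  #|[set I : {set 'I_(size S)} | `[< weighted_sum A I g >]]|.

(* The exponent is an integer, negative when |S| is small, so the power of 2
   is taken in the rationals. *)
Definition zero_complete (G : finZmodType) (A : set int) : Prop :=
  forall S : seq G,
    (2 : rat) ^ ((size S)%:Z - (davenport G A)%:Z + 1) <=
    (num_subseq A 0 S)%:R.

Definition weights (d k n : nat) : set int :=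
  ([set a : int | 1 <= a <= (d ^ k * n)%:Z - 1] `\`
   [set ((d ^ k * n) %/ d ^ j)%N%:Z | j in [set j | (1 <= j <= k)%N]])%classic.

Lemma zero_sum_length_card (G : finZmodType) (A : set int) :
  (exists a, A a) -> zero_sum_length G A #|G|.
Proof.
case=> a Aa; split=> [|S sizeS]; first by apply/card_gt0P; exists 0.
pose f (i : 'I_(#|G|.+1)) : G := \sum_(l < size S | (l < i)%N) S`_l.
have /injectivePn[i [j neq_ij eq_f]] : ~~ injectiveb f.
  by apply/negP => /injectiveP/leq_card; rewrite card_ord ltnn.
wlog lt_ij : i j neq_ij eq_f / (i < j)%N => [hw|].
  have [lt_ij|lt_ji|/val_inj eq_ij] := ltngtP i j.
  - exact: (hw i j).
  - by apply: (hw j i) => //; rewrite eq_sym.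
  - by rewrite eq_ij eqxx in neq_ij.
have lt_iS : (i < size S)%N by rewrite sizeS (leq_trans lt_ij) // -ltnS.
exists [set l : 'I_(size S) | (i <= l < j)%N]; split.
  by apply/set0Pn; exists (Ordinal lt_iS); rewrite inE /= leqnn.
exists (fun=> a); split=> //; rewrite -mulrz_suml.
suff -> : \sum_(l in [set l : 'I_(size S) | (i <= l < j)%N]) S`_l = 0
  by rewrite mul0rz.
apply: (addrI (f i)); rewrite addr0 [RHS]eq_f /f.
rewrite [RHS](bigID (fun l : 'I_(size S) => (l < i)%N)) /=; congr (_ + _).
  by apply: eq_bigl => l; case: ltnP => [lt_li|]; rewrite ?andbF ?andbT ?(ltn_trans lt_li).
by apply: eq_bigl => l; rewrite inE -leqNgt andbC.
Qed.

Lemma davenportP (G : finZmodType) (A : set int) : (exists a, A a) ->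
  zero_sum_length G A (davenport G A) /\
  forall t, zero_sum_length G A t -> (davenport G A <= t)%N.
Proof.
move=> A_ex; rewrite /davenport; case: pselect => [ex_t|[]]; last first.
  by exists #|G|; apply/asboolP/zero_sum_length_card.
by case: ex_minnP => m /asboolP ? m_min; split=> // t /asboolP/m_min.
Qed.

(* Main.v *)
(** Only the bound [D_A(G) >= r + 1] (from the standard basis of [C_m^r],
    [m = d^k n]) is needed.  Fix a prime [p | n].  As [d] does not divide [n],
    the weights [(m / p) b] with [0 < b < p] are all in [A]; they kill [H], and
    they turn the relations over [C_m^r] into linear relations over the field
    with [p] elements between the |S| reductions of the terms, which live in
    dimension [r].  Choosing a maximal independent subfamily [B] of these, every
    [J] disjoint from [B] is the trace outside [B] of the support of a relation,
    which gives at least [2^(|S| - r)] supports. *)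
Require Import Defs.
From mathcomp Require Import all_boot all_order all_algebra all_fingroup all_solvable.
From mathcomp Require Import boolp classical_sets.
From mathcomp Require Import zify.

Section WeightedSums.
Import Order.TTheory GRing.Theory Num.Theory.
Local Open Scope ring_scope.

Lemma card_kernel_supports (F : fieldType) (l r : nat) (M : 'M[F]_(l, r)) :
  (2 ^ (l - r) <=
   #|[set I : {set 'I_l} |
      `[< exists2 v : 'rV_l, v *m M = 0%R & I = [set i | v ord0 i != 0%R] >]]|)%N.
Proof.
set N := [set I | _].
pose B := [set maxrankfun M i | i : 'I_(\rank M)]%SET.
have cardB : #|B| = \rank M.
  by rewrite card_imset ?card_ord //; apply: maxrankfun_inj.
have traces : powerset (~: B) \subset [set I :&: ~: B | I in N].
  apply/fintype.subsetP => J; rewrite powersetE => sJB.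
  pose u : 'rV[F]_l := \row_i (i \in J)%:R.
  have /submxP[D uM] : (u *m M <= rowsub (maxrankfun M) M)%MS.
    by rewrite eq_maxrowsub submxMl.
  (* The rows of [rowsub (maxrankfun M) 1%:M] are the unit vectors indexed by [B], and the rows of
     [M] at [B] span its row space. Thus [v] lies in the kernel and agrees with the indicator [u] of
     [J] outside [B]. *)
  pose v := u - D *m rowsub (maxrankfun M) 1%:M.
  have vM : v *m M = 0 by rewrite mulmxBl -mulmxA mul_rowsub_mx mul1mx uM subrr.
  apply/imsetP; exists [set i | v ord0 i != 0].
    by rewrite inE; apply/asboolP; exists v.
  apply/setP => i; rewrite !inE; have [iB|iB] := boolP (i \in B).
    rewrite andbF; apply: contraTF iB => iJ.
    by have := fintype.subsetP sJB i iJ; rewrite inE.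
  rewrite andbT !mxE big1 ?subr0 => [|j _]; first by case: (i \in J); rewrite ?oner_eq0 ?eqxx.
  rewrite !mxE (_ : _ == i = false) ?mulr0 //.
  by apply: contraNF iB => /eqP <-; apply: imset_f.
have := leq_trans (subset_leq_card traces) (leq_imset_card _ _).
rewrite card_powerset; apply: leq_trans.
rewrite leq_exp2l // cardsCs finset.setCK card_ord cardB leq_sub2l //.
exact: rank_leq_col.
Qed.

Lemma davenport_gt_rank (H : finZmodType) (r m : nat) (A : set int) :
  (1 < m)%N -> (exists a, A a) ->
  (forall a, A a -> exists2 b : nat, a = b%:Z & (0 < b < m)%N) ->
  (r < davenport (H * {ffun 'I_r -> 'Z_m})%type A)%N.
Proof.
move=> m1 A_ex A_bnd; have [[D_gt0 zsD] _] :=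
  davenportP (H * {ffun 'I_r -> 'Z_m})%type A_ex.
move: zsD D_gt0; set D := davenport _ _ => zsD D_gt0.
rewrite ltnNge; apply/negP => leDr.
pose e (i : nat) : (H * {ffun 'I_r -> 'Z_m})%type :=
  (0, [ffun j : 'I_r => (i == j)%:R]).
have [|I [/set0Pn[i iI] [a [aA sum0]]]] := zsD (mkseq e D); first by rewrite size_mkseq.
have ltD (j : 'I_(size (mkseq e D))) : (j < D)%N.
  by apply: leq_trans (ltn_ord j) _; rewrite size_mkseq.
(* Coordinate [i] only sees the term [e i], so it equals the weight [a i] modulo [m], which is
   nonzero because [0 < a i < m]. *)
have := congr1 (fun x : H * {ffun 'I_r -> 'Z_m} => x.2 (Ordinal (leq_trans (ltD i) leDr))) sum0.
rewrite /= raddf_sum sum_ffunE (bigD1 i) //= big1 => [|j /andP[jI neq_ji]].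
  have [b -> /andP[b_gt0 ltbm]] := A_bnd _ (aA i iI).
  rewrite -pmulrn nth_mkseq // raddfMn ffunMnE ffunE eqxx addr0 ffunE.
  by move/(congr1 val); rewrite /= val_Zp_nat // modn_small // => b0; rewrite b0 in b_gt0.
have [b -> _] := A_bnd _ (aA j jI).
rewrite -pmulrn nth_mkseq //.
by rewrite raddfMn ffunMnE ffunE /= (negbTE (_ : j != i :> nat)) ?mul0rn.
Qed.

Lemma weights_bounded (d k n : nat) (a : int) : weights d k n a ->
  exists2 b : nat, a = b%:Z & (0 < b < d ^ k * n)%N.
Proof.
case=> /andP[]; case: a => // b b_ge1 b_le _; exists b => //.
by move: b_ge1 b_le; rewrite lerBrDr -PoszD !lez_nat addn1 => -> ->.
Qed.

Lemma weights_mul (d k n p b : nat) :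
  (0 < d)%N -> (0 < n)%N -> ~~ (d %| n)%N -> prime p -> (p %| n)%N ->
  (0 < b < p)%N -> weights d k n (d ^ k * (n %/ p) * b)%N.
Proof.
move=> d_gt0 n_gt0 d_n p_pr /dvdnP[q def_n] /andP[b_gt0 ltbp].
have p_gt0 := prime_gt0 p_pr; rewrite def_n mulnK //.
have q_gt0 : (0 < q)%N by move: n_gt0; rewrite def_n muln_gt0 => /andP[].
have dk_gt0 : (0 < d ^ k)%N by rewrite expn_gt0 d_gt0.
split=> /=.
  rewrite lerBrDr -PoszD !lez_nat !muln_gt0 dk_gt0 q_gt0 b_gt0 addn1.
  by rewrite -mulnA !ltn_pmul2l.
case=> j /andP[j_gt0 lejk] [].
have -> : (d ^ k * (q * p) %/ d ^ j = d ^ (k - j) * (q * p))%N.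
  by rewrite -{1}(subnK lejk) expnD mulnAC mulnK // expn_gt0 d_gt0.
move=> eq_w.
(* Equality with an excluded weight forces [p = b * d ^ j] with [j >= 1], so [d] divides [p] and
   hence [n]. *)
have {}eq_w : p = (b * d ^ j)%N.
  apply/eqP; rewrite -(eqn_pmul2l (m := d ^ (k - j) * q)%N) ?muln_gt0 ?expn_gt0 ?d_gt0 //.
  by rewrite -mulnA eq_w -{1}(subnK lejk) expnD; apply/eqP; lia.
case/negP: d_n; rewrite def_n dvdn_mull //.
by rewrite eq_w dvdn_mull // dvdn_exp.
Qed.

Lemma mulrn_exponent (H : finZmodType) (x : H) (c : nat) :
  (exponent [set: H] %| c)%N -> x *+ c = 0.
Proof.
case/dvdnP=> q ->; rewrite mulnC mulrnA -[x *+ _]FinRing.zmodXgE expg_exponent ?inE //.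
exact: mul0rn.
Qed.

Lemma natrZ_eq0 (m c : nat) : (1 < m)%N -> (c%:R == 0 :> 'Z_m) = (m %| c)%N.
Proof. by move=> m_gt1; rewrite -val_eqE /= val_Zp_nat. Qed.

Lemma natrF_eq0 (p c : nat) : prime p -> (c%:R == 0 :> 'F_p) = (p %| c)%N.
Proof. by move=> p_pr; rewrite -val_eqE /= val_Fp_nat. Qed.

(** The weights are [m / p] times the representatives of the [v_i] in [[0, p)]. The factor [m / p]
    kills [H]. In each cyclic coordinate the relation over ['F_p] supplies a further factor [p], so
    the sum is a multiple of [m]. *)
Lemma kernel_weighted_sum (H : finZmodType) (A : set int) (r m p : nat)
    (S : seq (H * {ffun 'I_r -> 'Z_m})) (v : 'rV['F_p]_(size S)) :
  (1 < m)%N -> prime p -> (p %| m)%N -> (exponent [set: H] %| m %/ p)%N ->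
  (forall b : nat, (0 < b < p)%N -> A (m %/ p * b)%N) ->
  v *m (\matrix_(i < size S, j < r) ((S`_i).2 j)%:R) = 0 ->
  weighted_sum A [set i | v ord0 i != 0] 0.
Proof.
move=> m_gt1 p_pr dvd_pm expH A_mul vM0.
pose w i : nat := v ord0 i; pose a i := (m %/ p * w i)%N.
exists (fun i => Posz (a i)); split=> [i|].
  rewrite inE => v_neq0; apply: A_mul; rewrite lt0n; apply/andP; split.
    by apply: contra v_neq0 => /eqP wi0; apply/eqP/val_inj.
  by rewrite -[X in (_ < X)%N](Fp_cast p_pr) ltn_ord.
(* Off the support the weight [a i] is 0, so the sum may run over all indices. *)
have -> : \sum_(i in [set i | v ord0 i != 0]) S`_i *~ a i
          = \sum_(i < size S) S`_i *+ a i.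
  rewrite big_mkcond; apply: eq_bigr => i _; rewrite inE -pmulrn.
  by case: eqP => //= v0; rewrite /a /w v0 muln0 mulr0n.
have sum1 : (\sum_(i < size S) S`_i *+ a i).1 = 0.
  rewrite raddf_sum big1 // => i _; rewrite raddfMn mulrn_exponent //.
  exact: dvdn_mulr.
have sum2 : (\sum_(i < size S) S`_i *+ a i).2 = 0.
  apply/ffunP => j; rewrite raddf_sum sum_ffunE ffunE.
  pose x (i : 'I_(size S)) : nat := (S`_i).2 j.
  have /(congr1 (fun u : 'rV_r => u ord0 j)) := vM0; rewrite !mxE => relj.
  have dvd_p : (p %| \sum_i w i * x i)%N.
    rewrite -natrF_eq0 // natr_sum; apply/eqP; rewrite -[RHS]relj; apply: eq_bigr => i _.
    by rewrite mxE natrM natr_Zp.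
  rewrite (eq_bigr (fun i => (m %/ p * (w i * x i))%N%:R)) => [|i _].
    rewrite -natr_sum -big_distrr; apply/eqP; rewrite natrZ_eq0 //.
    by rewrite -[X in (X %| _)%N](divnK dvd_pm) dvdn_pmul2l // divn_gt0 ?prime_gt0 // dvdn_leq // ltnW.
  by rewrite raddfMn ffunMnE -[in LHS](natr_Zp (_ j)) -mulrnA mulnC -mulnA.
by rewrite [LHS]surjective_pairing sum1 sum2.
Qed.

(** From [r < D] the integer exponent [|S| - D + 1] is at most [|S| - r], and truncating the latter
    at 0 can only increase it. *)
Lemma zero_complete_of_le (G : finZmodType) (A : set int) (r : nat) :
  (r < davenport G A)%N ->
  (forall S : seq G, (2 ^ (size S - r) <= num_subseq A 0%R S)%N) ->
  zero_complete G A.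
Proof.
move=> ltrD leN S.
apply: (@le_trans _ _ (2 ^ (size S - r))%N%:R); last by rewrite ler_nat.
by rewrite natrX exprnP ler_weXz2l //; lia.
Qed.

End WeightedSums.

Theorem theorem3p7 (d n k r : nat) (H : finZmodType) :
  (1 < d)%N -> (1 < n)%N -> (1 <= k)%N -> (1 <= r)%N ->
  (exponent [set: H] %| d ^ k)%N ->
  (gcdn d n <= d - 1)%N ->
  (6 <= d ^ k * n)%N ->
  zero_complete (H * {ffun 'I_r -> 'Z_(d ^ k * n)})%type (weights d k n).
Proof.
move=> d_gt1 n_gt1 k_ge1 r_ge1 expH gcd_dn m_ge6.
set m := (d ^ k * n)%N in m_ge6 *.
have d_n : ~~ (d %| n)%N.
  apply: contraL gcd_dn => /gcdn_idPl ->.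
  by rewrite -ltnNge ltn_subrL (ltnW d_gt1).
pose p := pdiv n.
have p_pr : prime p by rewrite pdiv_prime.
have p_n : (p %| n)%N by rewrite pdiv_dvd.
have m_gt1 : (1 < m)%N by apply: leq_trans m_ge6.
have A_mul b : (0 < b < p)%N -> weights d k n (m %/ p * b)%N.
  by move=> b_p; rewrite -muln_divA //; apply: weights_mul; rewrite // ltnW.
apply: (zero_complete_of_le _ _ r) => [|S].
  apply: davenport_gt_rank => //; last exact: weights_bounded.
  (* Taking [b = 1 < p] shows that the weight set is nonempty. *)
  by exists (Posz (m %/ p * 1)); apply: A_mul; rewrite prime_gt1.
pose M : 'M['F_p]_(size S, r) := (\matrix_(i < size S, j < r) ((S`_i).2 j)%:R)%R.
apply: leq_trans (card_kernel_supports _ _ _ M) _.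
apply/subset_leq_card/fintype.subsetP => I; rewrite !finset.inE => /asboolP[v vM ->].
apply/asboolP; apply: (kernel_weighted_sum _ _ _ _ p) vM => //.
  exact: dvdn_mull.
(* Since [p] divides [n], [m / p = d ^ k * (n / p)] is still a multiple of [d ^ k], hence of the
   exponent of [H]. *)
by rewrite -muln_divA // dvdn_mulr.
Qed.
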